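(* Let $\rho(n)=2^{-n}\sum_{f\in\mathbb{F}_2[x],\ \deg(f)=n}\tau(f)$ and $\rho_0(n)=2^{-n}\sum_{f\in\mathbb{F}_2[x],\ \deg(f)=n}\tau_0(f)$. Then $\lim_{n\to\infty}\frac{\rho(n)}{n}=2$ and $\lim_{n\to\infty}\frac{\rho_0(n)}{n}=3$.
   Context: Define $T:\mathbb{F}_2[x]\to\mathbb{F}_2[x]$ by $T(f)=\frac{f}{x+1}$ if $f(1)=0$ and $T(f)=\frac{xf+1}{x+1}$ if $f(1)=1$. For nonzero $f\in\mathbb{F}_2[x]$, $\tau(f)$ is the least $k\in\mathbb{N}$ with $T^k(f)=1$. Define the polynomial Collatz map $T_0:\mathbb{F}_2[x]\to\mathbb{F}_2[x]$ by $T_0(f)=\frac{f}{x}$ if $f(0)=0$ and $T_0(f)=(x+1)f+1$ if $f(0)=1$; for nonzero $f$, $\tau_0(f)$ is the least $k\in\mathbb{N}$ with $T_0^k(f)=1$. (These stopping times are finite.) *)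

(* Defs.v *)
From HB Require Import structures.
From mathcomp Require Import all_boot all_order all_algebra.
From mathcomp Require Import boolp classical_sets reals topology normedtype sequences.
Set Implicit Arguments. Unset Strict Implicit. Unset Printing Implicit Defensive.
Import Order.TTheory GRing.Theory Num.Theory.
Local Open Scope ring_scope.

Notation F2poly := {poly 'F_2}.

(* T(f) = f/(x+1) if f(1)=0, (x f + 1)/(x+1) if f(1)=1 (exact divisions) *)
Definition T (f : F2poly) : F2poly :=
  if f.[1] == 0 then f %/ ('X + 1) else ('X * f + 1) %/ ('X + 1).

Definition T0 (f : F2poly) : F2poly :=
  if f.[0] == 0 then f %/ 'X else ('X + 1) * f + 1.

(* least k with (iter k g f) = 1; 0 if no such k exists (never happens for f != 0) *)
Definition stop_time (g : F2poly -> F2poly) (f : F2poly) : nat :=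
  match pselect (exists k, iter k g f == 1) with
  | left H => ex_minn H
  | right _ => 0%N
  end.

Definition tau := stop_time T.
Definition tau0 := stop_time T0.

(* the degree-n polynomial x^n + sum_{i<n} c_i x^i ; these enumerate all
   polynomials of degree exactly n over F_2 bijectively *)
Definition monic_of (n : nat) (c : {ffun 'I_n -> 'F_2}) : F2poly :=
  'X^n + \sum_(i < n) c i *: 'X^i.

Definition rho_gen (R : realType) (st : F2poly -> nat) (n : nat) : R :=
  (2%:R ^+ n)^-1 * \sum_(c : {ffun 'I_n -> 'F_2}) (st (monic_of c))%:R.

Definition rho (R : realType) := rho_gen R tau.
Definition rho0 (R : realType) := rho_gen R tau0.

(* Main.v *)
Require Import Defs.
From mathcomp Require Import all_boot all_order all_algebra.
From mathcomp Require Import boolp classical_sets reals topology normedtype.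
From mathcomp Require Import sequences zify ring lra.
Set Implicit Arguments.
Unset Strict Implicit.
Unset Printing Implicit Defensive.

Import Order.TTheory GRing.Theory Num.Theory numFieldNormedType.Exports.
Local Open Scope ring_scope.

(** Put [y = x + 1] and call a step of [T] odd or even according to the parity
    [f(1)].  An even step lowers the degree by one and an odd step preserves
    it, so [tau f] is [deg f] plus the number of odd steps, and the claim on
    [rho] is that on average there are about as many odd as even steps.

    After [k] steps, [o] of them odd, [y^k T^k(f) = x^o f + c] with
    [deg c < k].  Hence the first [m] parities determine [f] modulo [y^m], and
    [T^k(f)], when of degree [d], determines all but the [n - d] lowest
    coefficients of an [f] of degree [n].  So on
    [{f : deg f = n, deg T^k(f) = d}] the [d] parities starting at time [k]
    together with the first [n - d] parities determine [f]: at most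
    [2^(n - L)] of these [f] have a given block of [L <= d] parities at time
    [k].  By Chernoff's bound exponentially few blocks are imbalanced, and as
    the orbit reaches [1] within [(n + 1)^2] steps, a union bound over [k] and
    [d] applies with [L] of order [n^(1/3)].  If all blocks are balanced, then
    [tau f = 2 n + o(n)]; the exceptional [f] are too few to matter.

    Finally, substituting [x + 1] for [x] conjugates an even step of [T] to
    one step of [T0] and an odd step to two, so that
    [tau0 (f(x + 1)) + deg f = 2 tau f] and [rho0 n = 2 rho n - n]. *)

(** * Elementary estimates *)

Lemma size_sub_monic (R : nzRingType) (p q : {poly R}) :
  p \is monic -> q \is monic -> size p = size q ->
  (size (p - q)%R <= (size p).-1)%N.
Proof.
move=> /monicP p1 /monicP q1 pq; apply/leq_sizeP => j.
rewrite leq_eqVlt => /predU1P[<-|pj]; rewrite coefB.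
  by rewrite -[p`__]/(lead_coef p) p1 pq -[q`__]/(lead_coef q) q1 subrr.
by rewrite !nth_default ?subrr -?pq // (leq_trans (leqSpred _) pj).
Qed.

Lemma leq_card_bigcup (I U : finType) (B : I -> {set U}) :
  (#|\bigcup_i B i| <= \sum_i #|B i|)%N.
Proof.
elim/big_ind2: _ => [|A m C p Am Cp|//]; first by rewrite cards0.
by rewrite (leq_trans (leq_card_setU _ _)) // leq_add.
Qed.

Lemma floor_root k n : (0 < k)%N -> exists m, (m ^ k <= n < m.+1 ^ k)%N.
Proof.
move=> k0; elim: n => [|n [m /andP[mn nm]]].
  by exists 0%N; rewrite exp0n // exp1n.
have [ltn_m|le_mn] := ltnP n.+1 (m.+1 ^ k); first by exists m; rewrite leqW.
by exists m.+1; rewrite le_mn (leq_ltn_trans nm) // ltn_exp2r.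
Qed.

Lemma distn_natr (R : numDomainType) (m n : nat) :
  `|m%:R - n%:R| = `|m - n|%N%:R :> R.
Proof. by rewrite natr_absz intr_norm rmorphB. Qed.

Lemma bernoulli_ineq (R : realDomainType) (x : R) n :
  -1 <= x -> 1 + n%:R * x <= (1 + x) ^+ n.
Proof.
move=> x1; elim: n => [|n IHn]; first by rewrite expr0; lra.
rewrite exprSr -natr1; apply: le_trans (_ : (1 + n%:R * x) * (1 + x) <= _).
  have : 0 <= n%:R * x ^+ 2 by rewrite mulr_ge0 ?sqr_ge0.
  by nra.
by rewrite ler_wpM2r //; lra.
Qed.

Lemma natr_mul_exprn_le (R : realFieldType) (q : R) m :
  0 < q -> q < 1 -> m%:R * q ^+ m <= (q^-1 - 1)^-1.
Proof.
move=> q0 q1; have h0 : 0 < q^-1 - 1 by rewrite subr_gt0 invf_gt1.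
rewrite -ler_pdivlMr ?exprn_gt0 // mulrC ler_pdivlMr // -exprVn.
suff : 1 + m%:R * (q^-1 - 1) <= q^-1 ^+ m by lra.
by rewrite -[in leRHS](subrKC 1 q^-1) bernoulli_ineq //; lra.
Qed.

(** * Imbalanced subsets of a finite set *)

Definition imbalance (I : finType) (J : {set I}) : nat := `|#|J| - #|~: J| |.

Lemma sum_exprn_card (R : comPzSemiRingType) (I : finType) (a b : R) :
  \sum_(J : {set I}) a ^+ #|J| * b ^+ #|~: J| = (a + b) ^+ #|I|.
Proof.
rewrite -prodr_const bigA_distr; apply: eq_bigr => J _.
rewrite (bigID (mem J)) /= -[#|J|]sum1_card -[#|~: J|]sum1_card -!prodrXr.
congr (_ * _); first by apply: eq_bigr => i ->.
by apply: eq_big => i; rewrite ?inE // => /negPf ->.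
Qed.

Section Chernoff.
Variable R : realFieldType.

(* Exponential moments: weight [J] by [a ^ (#|J| - #|~: J|)], and symmetrically
   for the opposite imbalance. *)
Lemma card_imbalanced_exprn (a : R) (I : finType) l : 1 <= a ->
  #|[set J : {set I} | (l <= imbalance J)%N]|%:R * a ^+ l <=
    2 * (a + a^-1) ^+ #|I|.
Proof.
move=> a1; have a0 : 0 < a by apply: lt_le_trans a1.
pose weight m p := a ^+ m * a^-1 ^+ p.
have weight_ge0 m p : 0 <= weight m p.
  by rewrite mulr_ge0 ?exprn_ge0 ?invr_ge0 ?(ltW a0).
have weight_ge m p : (l + p <= m)%N -> a ^+ l <= weight m p.
  move=> lpm; rewrite /weight exprVn ler_pdivlMr ?exprn_gt0 // -exprD.
  exact: ler_weXn2l.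
have -> : 2 * (a + a^-1) ^+ #|I| =
    \sum_(J : {set I}) (weight #|J| #|~: J| + weight #|~: J| #|J|).
  rewrite big_split /=; under [X in _ = _ + X]eq_bigr do rewrite /weight mulrC.
  by rewrite !sum_exprn_card [a^-1 + a]addrC mulr_natl.
set A := [set J | _]; rewrite mulr_natl -sumr_const.
rewrite [leRHS](bigID (mem A)) /= ler_wpDr ?sumr_ge0 // => [J _|].
  by rewrite addr_ge0.
apply: ler_sum => J; rewrite inE /imbalance => imbJ.
have [lJ|lJ] : (l + #|~: J| <= #|J|)%N \/ (l + #|J| <= #|~: J|)%N by lia.
  by rewrite ler_wpDr ?weight_ge.
by rewrite ler_wpDl ?weight_ge.
Qed.

(* The base [2 ^ - N * (a + a^-1) ^ N / a] of the resulting bound for sets of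
   [N * l] elements, at [a = 1 + 1 / N]. *)
Definition chernoff_rate (N : nat) : R :=
  let a := 1 + N%:R^-1 in ((a + a^-1) / 2) ^+ N / a.

Lemma chernoff_rate_gt0 N : 0 < chernoff_rate N.
Proof.
have a0 : 0 < 1 + N%:R^-1 :> R by rewrite ltr_pwDl ?invr_ge0.
by rewrite divr_gt0 // exprn_gt0 // divr_gt0 // addr_gt0 // invr_gt0.
Qed.

Lemma chernoff_rate_lt1 N : (0 < N)%N -> chernoff_rate N < 1.
Proof.
move=> N0; rewrite /chernoff_rate; set x : R := N%:R^-1.
have x0 : 0 < x by rewrite invr_gt0 ltr0n.
have x1 : x <= 1 by rewrite invf_le1 ?ltr0n // ler1n.
have Nx : N%:R * x = 1 by rewrite mulfV // gt_eqF // ltr0n.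
pose u := x ^+ 2 / (2 * (1 + x)).
have -> : (1 + x + (1 + x)^-1) / 2 = 1 + u by rewrite /u; field; lra.
have Nu : N%:R * u = x / (2 * (1 + x)).
  by rewrite /u expr2 -mulrA mulrA Nx mul1r.
have u0 : 0 <= u by rewrite divr_ge0 ?exprn_ge0 //; lra.
have u1 : u <= 1 by rewrite ler_pdivrMr; nra.
have pow_ge : (2 + x) / (2 * (1 + x)) <= (1 - u) ^+ N.
  have -> : (2 + x) / (2 * (1 + x)) = 1 + N%:R * - u.
    by rewrite mulrN Nu; field; lra.
  by rewrite bernoulli_ineq //; lra.
have prod_le1 : (1 + u) ^+ N * (1 - u) ^+ N <= 1.
  by rewrite -exprMn exprn_ile1 //; nra.
have : (1 + u) ^+ N * ((2 + x) / (2 * (1 + x))) <= 1.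
  by apply: le_trans prod_le1; rewrite ler_wpM2l // exprn_ge0 // addr_ge0.
rewrite ltr_pdivrMr ?mul1r; last by lra.
rewrite mulrA ler_pdivrMr; last by lra.
by nra.
Qed.

Lemma card_imbalanced_chernoff (I : finType) N l : #|I| = (N * l)%N ->
  #|[set J : {set I} | (l <= imbalance J)%N]|%:R <=
    2 * 2 ^+ #|I| * chernoff_rate N ^+ l.
Proof.
move=> cardI; pose a : R := 1 + N%:R^-1.
have a1 : 1 <= a by rewrite lerDl invr_ge0.
have a0 : 0 < a by apply: lt_le_trans a1.
have -> : 2 * 2 ^+ #|I| * chernoff_rate N ^+ l =
    2 * (a + a^-1) ^+ #|I| / a ^+ l.
  rewrite /chernoff_rate -/a cardI expr_div_n -exprM [(_ / 2) ^+ _]expr_div_n.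
  by field; rewrite !expf_neq0 ?gt_eqF.
by rewrite ler_pdivlMr ?exprn_gt0 // card_imbalanced_exprn.
Qed.

End Chernoff.

(** * Parities and degrees along an orbit *)

Local Notation X1 := (polyX 'F_2 + 1).

Implicit Types f g : F2poly.

Definition deg f : nat := (size f).-1.

Definition parity f : bool := f.[1] != 0.

Definition odd_count k f : nat := \sum_(i < k) parity (iter i T f).

Lemma F2_neq0_eq1 (a : 'F_2) : a != 0 -> a = 1.
Proof. by case: a => [[|[|m]] //= ?] _; apply: val_inj. Qed.

Lemma F2poly_monic f : f != 0 :> F2poly -> f \is monic.
Proof. by rewrite monicE -lead_coef_eq0 => /F2_neq0_eq1 ->. Qed.

Lemma pchar_F2poly : 2%N \in [pchar F2poly].
Proof. by rewrite pchar_poly pchar_Fp. Qed.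

Lemma X1E : X1 = 'X - 1%:P.
Proof. by rewrite (oppr_pchar2 pchar_F2poly). Qed.

Lemma size_expX1 k : size (X1 ^+ k) = k.+1.
Proof. by rewrite X1E size_exp_XsubC. Qed.

Lemma X1_neq0 : X1 != 0.
Proof. by rewrite X1E polyXsubC_eq0. Qed.

Lemma size_deg f : f != 0 -> size f = (deg f).+1.
Proof. by rewrite -size_poly_gt0 /deg => /prednK. Qed.

Lemma deg1 : deg 1 = 0%N.
Proof. by rewrite /deg size_poly1. Qed.

Lemma T_mul f : X1 * T f = if parity f then 'X * f + 1 else f.
Proof.
rewrite /T /parity mulrC; case: eqP => [f1|/eqP/F2_neq0_eq1 f1] /=.
  by rewrite divpK // X1E dvdp_XsubCl; apply/rootP.
rewrite divpK // X1E dvdp_XsubCl; apply/rootP.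
by rewrite !hornerE f1 (addrr_pchar2 (pchar_Fp _)).
Qed.

Lemma parity1 : parity 1.
Proof. by rewrite /parity hornerC oner_eq0. Qed.

Lemma T1 : T 1 = 1.
Proof. by apply: (mulfI X1_neq0); rewrite T_mul parity1 !mulr1. Qed.

Lemma iter_T1 k : iter k T 1 = 1.
Proof. by elim: k => //= k ->; apply: T1. Qed.

Lemma T_neq0 f : f != 0 -> T f != 0.
Proof.
apply: contraNneq => Tf; have := T_mul f; rewrite Tf mulr0.
case: ifP => [_|_ <- //] /(congr1 (horner^~ 0)).
by rewrite !hornerE => /esym/eqP; rewrite oner_eq0.
Qed.

Lemma iter_T_neq0 k f : f != 0 -> iter k T f != 0.
Proof. by move=> f0; elim: k => //= k; apply: T_neq0. Qed.

Lemma deg_T f : f != 0 -> (deg (T f)).+1 = (deg f + parity f)%N.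
Proof.
move=> f0; have -> : (deg (T f)).+1 = deg (X1 * T f).
  rewrite [RHS]/deg size_mul ?X1_neq0 ?T_neq0 // X1E size_XsubC.
  by rewrite size_deg ?T_neq0.
rewrite T_mul; case: parity; last by rewrite addn0.
by rewrite /deg mulrC -polyC1 size_MXaddC (negPf f0) size_deg // addn1.
Qed.

Lemma odd_countS k f : odd_count k.+1 f = (parity f + odd_count k (T f))%N.
Proof.
by rewrite /odd_count big_ord_recl; under eq_bigr do rewrite /= -iterS iterSr.
Qed.

Lemma odd_countSr k f :
  odd_count k.+1 f = (odd_count k f + parity (iter k T f))%N.
Proof. exact: big_ord_recr. Qed.

Lemma deg_iter_T k f : f != 0 ->
  (deg (iter k T f) + k = deg f + odd_count k f)%N.
Proof.
elim: k f => [|k IHk] f f0; first by rewrite /odd_count big_ord0.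
by rewrite iterSr addnS IHk ?T_neq0 // -addSn deg_T // odd_countS addnA.
Qed.

Lemma odd_count_leq k f : (odd_count k f <= k)%N.
Proof.
by rewrite -[leqRHS]card_ord -sum1_card; apply: leq_sum => i _; case: parity.
Qed.

Lemma deg_iter_T_leq k f : f != 0 -> (deg (iter k T f) <= deg f)%N.
Proof.
by move=> f0; have := deg_iter_T k f0; have := odd_count_leq k f; lia.
Qed.

Lemma iter_T_mul k f : exists2 c : F2poly,
  X1 ^+ k * iter k T f = 'X^(odd_count k f) * f + c & (size c <= k)%N.
Proof.
elim: k => [|k [c IHk sc]].
  by exists 0; rewrite ?size_poly0 // /odd_count big_ord0 !expr0 addr0.
have -> : X1 ^+ k.+1 * iter k.+1 T f = X1 ^+ k * (X1 * T (iter k T f)).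
  by rewrite exprSr -mulrA.
rewrite T_mul odd_countSr; case: parity; last first.
  by exists c; rewrite ?addn0 // leqW.
exists ('X * c + X1 ^+ k).
  by rewrite addn1 mulrDr mulr1 mulrCA IHk exprS mulrDr mulrA addrA.
rewrite (leq_trans (size_polyD _ _)) // geq_max size_expX1 leqnn andbT.
by rewrite (leq_trans (size_polyMleq _ _)) // size_polyX.
Qed.

Definition same_parities m f g : Prop :=
  forall i, (i < m)%N -> parity (iter i T f) = parity (iter i T g).

Lemma same_parities_cat m p f g :
  same_parities m f g -> same_parities p (iter m T f) (iter m T g) ->
  same_parities (m + p) f g.
Proof.
move=> fg mfg i; have [im _|mi ip] := ltnP i m; first exact: fg.
by have := mfg (i - m)%N; rewrite -!iterD subnK // ltn_subLR //; apply.
Qed.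

Lemma same_parities_dvdp m f g : same_parities m f g -> X1 ^+ m %| f - g.
Proof.
elim: m f g => [|m IHm] f g fg; first by rewrite expr0 dvd1p.
have dvd_T : X1 ^+ m.+1 %| X1 * T f - X1 * T g.
  rewrite -mulrBr exprS dvdp_mul // IHm // => i im.
  by rewrite -!iterSr fg.
move: dvd_T; rewrite !T_mul -(fg 0%N isT); case: parity => //=.
have -> : 'X * f + 1 - ('X * g + 1) = 'X * (f - g) :> F2poly.
  by rewrite opprD addrACA subrr addr0 mulrBr.
rewrite Gauss_dvdpr // coprimep_expl // coprimepX /root.
by rewrite !hornerE oner_eq0.
Qed.

Lemma same_parities_eq m f g :
  same_parities m f g -> (size (f - g)%R <= m)%N -> f = g.
Proof.
move=> /same_parities_dvdp dvd small; apply/eqP; rewrite -subr_eq0.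
apply: contraLR small => fg0; rewrite -ltnNge.
by have := dvdp_leq fg0 dvd; rewrite size_expX1.
Qed.

Lemma size_sub_deg f g :
  f != 0 -> g != 0 -> deg f = deg g -> (size (f - g)%R <= deg f)%N.
Proof.
by move=> f0 g0 fg; apply: size_sub_monic; rewrite ?F2poly_monic ?size_deg ?fg.
Qed.

Lemma size_sub_iter_T k f g : f != 0 -> g != 0 -> deg f = deg g ->
  iter k T f = iter k T g -> (size (f - g)%R <= deg f - deg (iter k T f))%N.
Proof.
move=> f0 g0 fg Tfg; have := deg_iter_T k f0; have := deg_iter_T k g0.
rewrite -Tfg -fg => -> /eqP; rewrite eqn_add2l => /eqP ofg.
have [-> | fg0] := eqVneq (f - g) 0; first by rewrite size_poly0.
have [c fc sc] := iter_T_mul k f; have [c' gc' sc'] := iter_T_mul k g.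
have Xfg : 'X^(odd_count k f) * (f - g) = c' - c.
  apply/eqP; rewrite mulrBr subr_eq addrAC eq_sym subr_eq addrC.
  by rewrite -fc Tfg -ofg -gc'.
have : (size ('X^(odd_count k f) * (f - g))%R <= k)%N.
  by rewrite Xfg (leq_trans (size_polyD _ _)) // size_polyN geq_max sc sc'.
rewrite size_monicM ?monicXn // size_polyXn addSn /=.
by have := deg_iter_T k f0; lia.
Qed.

(* Only the low [deg f - deg (T ^ k f)] coefficients of [f] are lost in
   [T ^ k f]; the first parities recover them. *)
Lemma iter_T_inj k f g : f != 0 -> g != 0 -> deg f = deg g ->
  deg (iter k T f) = deg (iter k T g) ->
  same_parities (deg f - deg (iter k T f)) f g ->
  same_parities (deg (iter k T f)) (iter k T f) (iter k T g) ->
  f = g.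
Proof.
move=> f0 g0 dfg dTfg fg Tfg; apply: same_parities_eq fg _.
apply: size_sub_iter_T => //; apply: same_parities_eq Tfg _.
by apply: size_sub_deg; rewrite ?iter_T_neq0.
Qed.

Lemma odd_count_eq_same_parities k f : odd_count k f = k -> same_parities k f 1.
Proof.
elim: k => // k IHk; rewrite odd_countSr => odd_k i; have := odd_count_leq k f.
rewrite ltnS [(i <= k)%N]leq_eqVlt => le_k /predU1P[->|ik].
  by rewrite iter_T1 parity1; case: parity odd_k => //; lia.
by apply: IHk ik; case: parity odd_k; lia.
Qed.

(* With [deg f + 1] odd steps in a row, [f] would have the parities of the fixed
   point [1]. *)
Lemma deg_iter_T_lt f : f != 0 -> f != 1 ->
  (deg (iter (deg f).+1 T f) < deg f)%N.
Proof.
move=> f0 f1; have := deg_iter_T (deg f).+1 f0.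
suff : (odd_count (deg f).+1 f < (deg f).+1)%N by lia.
rewrite ltn_neqAle odd_count_leq andbT.
apply: contra_neq f1 => /odd_count_eq_same_parities f_1.
apply: same_parities_eq f_1 _.
rewrite (leq_trans (size_polyD _ _)) // size_polyN size_poly1 geq_max.
by rewrite size_deg // leqnn.
Qed.

Lemma iter_T_eq1 k f : f != 0 -> ((deg f).+1 ^ 2 <= k)%N -> iter k T f = 1.
Proof.
have [n] := ubnP (deg f); elim: n f k => // n IHn f k dfn f0 dfk.
have [-> | f1] := eqVneq f 1; first exact: iter_T1.
have lt := deg_iter_T_lt f0 f1; rewrite -(@subnK (deg f).+1 k); last by nia.
by rewrite iterD IHn ?iter_T_neq0 //; nia.
Qed.

(** * Stopping times *)

Definition stops_at (step : F2poly -> F2poly) f k : Prop :=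
  iter k step f = 1 /\ forall i, (i < k)%N -> iter i step f != 1.

Lemma stop_timeP step f :
  (exists k, iter k step f = 1) -> stops_at step f (stop_time step f).
Proof.
move=> [k reach_k]; rewrite /stop_time; case: pselect => [hit | []]; last first.
  by exists k; apply/eqP.
case: ex_minnP => m /eqP reach_m m_min; split=> // i im.
by apply: contraTneq im => /eqP/m_min; rewrite -leqNgt.
Qed.

Lemma stops_at_inj step f k m : stops_at step f k -> stops_at step f m -> k = m.
Proof.
move=> [reach_k ltk] [reach_m ltm]; case: (ltngtP k m) => // [/ltm|/ltk].
  by rewrite reach_k eqxx.
by rewrite reach_m eqxx.
Qed.

Lemma stop_timeE step f k : stops_at step f k -> stop_time step f = k.
Proof.
move=> stop_k; apply: (stops_at_inj (stop_timeP _) stop_k).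
by exists k; case: stop_k.
Qed.

Lemma stops_atS step f k :
  f != 1 -> stops_at step (step f) k -> stops_at step f k.+1.
Proof.
move=> f1 [reach_k ltk]; split; first by rewrite iterSr.
by case=> // i ik; rewrite iterSr ltk.
Qed.

Lemma stops_at_iter step f k m :
  stops_at step f (m + k) -> stops_at step (iter k step f) m.
Proof.
move=> [reach ltmk]; split; first by rewrite -iterD.
by move=> i im; rewrite -iterD ltmk // ltn_add2r.
Qed.

Lemma tauP f : f != 0 -> stops_at T f (tau f).
Proof.
by move=> f0; apply: stop_timeP; exists ((deg f).+1 ^ 2)%N; apply: iter_T_eq1.
Qed.

Lemma tau_leq f : f != 0 -> (tau f <= (deg f).+1 ^ 2)%N.
Proof.
move=> f0; rewrite leqNgt; apply/negP => /(proj2 (tauP f0)).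
by rewrite iter_T_eq1 ?eqxx.
Qed.

Lemma tauE f : f != 0 -> tau f = (deg f + odd_count (tau f) f)%N.
Proof.
by move=> f0; rewrite -deg_iter_T // (proj1 (tauP f0)) deg1.
Qed.

Lemma tau_iter_T k f :
  f != 0 -> (k <= tau f)%N -> tau f = (k + tau (iter k T f))%N.
Proof.
move=> f0 kt; rewrite -[LHS](subnK kt) addnC; congr addn; apply/esym/stop_timeE.
by apply: stops_at_iter; rewrite subnK //; apply: tauP.
Qed.

(** * Conjugating [T0] with [T] *)

Lemma X1_comp : X1 \Po X1 = 'X.
Proof.
rewrite comp_polyD comp_polyX comp_polyC -addrA.
by rewrite (addrr_pchar2 pchar_F2poly) addr0.
Qed.

Lemma comp_X1K f : (f \Po X1) \Po X1 = f.
Proof. by rewrite -comp_polyA X1_comp comp_polyXr. Qed.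

Lemma T0_comp_even f : ~~ parity f -> T0 (f \Po X1) = T f \Po X1.
Proof.
move=> even_f; have := T_mul f; rewrite (negPf even_f) => Tf.
rewrite /T0 horner_comp !hornerE -[_ == 0]negbK even_f -[in LHS]Tf.
by rewrite comp_polyM X1_comp mulrC mulpK // polyX_eq0.
Qed.

Lemma T0_comp_odd f : parity f -> T0 (f \Po X1) = 'X * (T f \Po X1).
Proof.
move=> odd_f; rewrite /T0 horner_comp !hornerE ifN //.
have := congr1 (comp_poly X1) (T_mul f).
by rewrite odd_f comp_polyM X1_comp comp_polyD comp_polyM comp_polyX comp_polyC.
Qed.

Lemma T0_mulX f : T0 ('X * f) = f.
Proof. by rewrite /T0 !hornerE eqxx mulrC mulpK // polyX_eq0. Qed.

Lemma stops_at_T0_comp f k :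
  stops_at T f k -> stops_at T0 (f \Po X1) (k + odd_count k f).
Proof.
elim: k f => [|k IHk] f [Tk1 ltk].
  by rewrite /odd_count big_ord0 [f]Tk1; split; rewrite ?comp_polyC.
have {IHk} stop_Tf : stops_at T0 (T f \Po X1) (k + odd_count k (T f)).
  by apply: IHk; apply: (@stops_at_iter _ f 1); rewrite addn1; split.
have f1 : f \Po X1 != 1.
  apply: contra_neq (ltk 0%N isT) => /(congr1 (comp_poly X1)).
  by rewrite comp_X1K comp_polyC.
rewrite odd_countS; have [odd_f|even_f] := boolP (parity f); last first.
  by rewrite addSn; apply: stops_atS; rewrite ?T0_comp_even.
rewrite addSn addnCA add1n; apply: stops_atS; rewrite ?T0_comp_odd //.
apply: stops_atS; rewrite ?T0_mulX //.
apply: contra_neq (oner_neq0 'F_2) => /(congr1 (horner^~ 0)).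
by rewrite !hornerE => <-.
Qed.

Lemma tau0_comp f : f != 0 -> (tau0 (f \Po X1) + deg f = 2 * tau f)%N.
Proof.
move=> f0; rewrite /tau0 (stop_timeE (stops_at_T0_comp (tauP f0))).
by have := tauE f0; lia.
Qed.

(** * Orbits with balanced blocks *)

Definition odd_times L f : {set 'I_L} := [set i : 'I_L | parity (iter i T f)].

Lemma card_odd_times L f : #|odd_times L f| = odd_count L f.
Proof.
rewrite -sum1_card big_mkcond; apply: eq_bigr => i _.
by rewrite inE; case: parity.
Qed.

Lemma imbalance_odd_times L f :
  imbalance (odd_times L f) = `|L - 2 * odd_count L f|%N.
Proof.
have := cardsC (odd_times L f); rewrite /imbalance card_odd_times card_ord.
by move: #|_| => e; lia.
Qed.

Lemma odd_times_eq L f g : odd_times L f = odd_times L g -> same_parities L f g.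
Proof. by move=> /setP fg i iL; have := fg (Ordinal iL); rewrite !inE. Qed.

Definition balanced_orbit L l f : Prop :=
  forall k, (L <= deg (iter k T f))%N ->
    (imbalance (odd_times L (iter k T f)) < l)%N.

(* A balanced block of [L] steps lowers the degree by [D] with [|L - 2 D| < l],
   which is at most [2 D / P]. *)
Lemma tau_balanced P l f : (0 < P)%N -> (0 < l)%N -> f != 0 ->
  balanced_orbit (P.+1 * l) l f ->
  (P * `|tau f - 2 * deg f| <= 2 * deg f + P * (P.+1 * l) ^ 2)%N.
Proof.
move=> P0 l0; set L := (P.+1 * l)%N.
have [n] := ubnP (deg f); elim: n f => // n IHn f dfn f0 bal_f.
have [dfL|Ldf] := ltnP (deg f) L.
  have le_L2 : ((deg f).+1 ^ 2 <= L ^ 2)%N by rewrite leq_exp2r.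
  have := tau_leq f0; have := tauE f0; set t := tau f; nia.
set g := iter L T f.
have := bal_f 0%N Ldf; rewrite imbalance_odd_times /= => imb.
have degL : (deg g + L = deg f + odd_count L f)%N := deg_iter_T L f0.
have L_split : L = (P * l + l)%N by rewrite /L mulSn addnC.
have Pl0 : (0 < P * l)%N by rewrite muln_gt0 P0.
have block : (P * `|L - 2 * (deg f - deg g)| <= 2 * (deg f - deg g))%N.
  apply: (@leq_trans (P * l)); last by lia.
  by rewrite leq_mul2l; lia.
have tau_g : tau f = (L + tau g)%N.
  by apply: tau_iter_T => //; rewrite tauE // (leq_trans Ldf) ?leq_addr.
have IHg : (P * `|tau g - 2 * deg g| <= 2 * deg g + P * L ^ 2)%N.
  apply: IHn; rewrite ?iter_T_neq0 //; first by lia.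
  by move=> k; rewrite -iterD; apply: bal_f.
have triangle : (`|tau f - 2 * deg f| <=
    `|tau g - 2 * deg g| + `|L - 2 * (deg f - deg g)|)%N by lia.
rewrite (leq_trans (leq_mul (leqnn P) triangle)) // mulnDr.
by rewrite (leq_trans (leq_add IHg block)) //; lia.
Qed.

(** * Counting unbalanced orbits *)

Lemma coef_monic_of n (c : {ffun 'I_n -> 'F_2}) (i : 'I_n) :
  (monic_of c)`_i = c i.
Proof.
rewrite /monic_of coefD coefXn ltn_eqF // add0r coef_sum (bigD1 i) //=.
rewrite coefZ coefXn eqxx mulr1 big1 ?addr0 // => j ji.
by rewrite coefZ coefXn eq_sym (negPf (ji : (j != i :> nat))) mulr0.
Qed.

Lemma size_monic_of n (c : {ffun 'I_n -> 'F_2}) : size (monic_of c) = n.+1.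
Proof.
rewrite /monic_of size_polyDl ?size_polyXn // ltnS.
apply: (leq_trans (size_sum _ _ _)); apply/bigmax_leqP => i _.
by rewrite (leq_trans (size_scale_leq _ _)) // size_polyXn.
Qed.

Lemma deg_monic_of n (c : {ffun 'I_n -> 'F_2}) : deg (monic_of c) = n.
Proof. by rewrite /deg size_monic_of. Qed.

Lemma monic_of_neq0 n (c : {ffun 'I_n -> 'F_2}) : monic_of c != 0.
Proof. by rewrite -size_poly_eq0 size_monic_of. Qed.

Lemma monic_of_inj n : injective (@monic_of n).
Proof.
by move=> c c' eq_cc'; apply/ffunP => i; rewrite -!coef_monic_of eq_cc'.
Qed.

Lemma monic_of_coef n f : f \is monic -> size f = n.+1 ->
  monic_of [ffun i : 'I_n => f`_i] = f.
Proof.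
move=> f_monic sf; set h := monic_of _; have h_monic : h \is monic.
  by rewrite F2poly_monic ?monic_of_neq0.
apply/polyP => i; case: (ltngtP i n) => [lt_in|lt_ni|->].
- by rewrite (coef_monic_of _ (Ordinal lt_in)) ffunE.
- by rewrite !nth_default ?size_monic_of ?sf.
move/monicP: f_monic; move/monicP: h_monic; rewrite /lead_coef sf size_monic_of.
by move=> -> ->.
Qed.

(* The block, the remaining parities after time [k] and the first [n - d] ones
   determine the polynomial by [iter_T_inj]. *)
Lemma card_odd_times_block n k d L (S : {set {set 'I_L}}) :
  (L <= d)%N -> (d <= n)%N ->
  (#|[set c : {ffun 'I_n -> 'F_2} | (deg (iter k T (monic_of c)) == d) &&
       (odd_times L (iter k T (monic_of c)) \in S)]| * 2 ^ L <= #|S| * 2 ^ n)%N.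
Proof.
move=> Ld dn; set A := [set c | _].
pose code (c : {ffun 'I_n -> 'F_2}) := let f := monic_of c in
  (odd_times L (iter k T f),
   (odd_times (d - L) (iter L T (iter k T f)), odd_times (n - d) f)).
have code_inj : {in A &, injective code}.
  move=> c c'; rewrite !inE => /andP[/eqP dc _] /andP[/eqP dc' _].
  move=> [/odd_times_eq block /odd_times_eq rest /odd_times_eq start].
  apply: monic_of_inj; apply: (@iter_T_inj k);
    rewrite ?monic_of_neq0 ?deg_monic_of ?dc ?dc' //.
  by rewrite -(subnKC Ld); apply: same_parities_cat.
have -> : (2 ^ n = 2 ^ (d - L) * 2 ^ (n - d) * 2 ^ L)%N.
  by rewrite -!expnD; congr expn; lia.
rewrite mulnA leq_mul2r expn_eq0 /= -(card_in_imset code_inj).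
pose codes := finset.setX S
  (finset.setX [set: {set 'I_(d - L)}] [set: {set 'I_(n - d)}]).
apply: (@leq_trans #|codes|).
  apply/subset_leq_card/fintype.subsetP => _ /imsetP[c cA ->].
  by move: cA; rewrite !inE => /andP[_ ->].
by rewrite /codes !cardsX -!powersetT !card_powerset !cardsT !card_ord.
Qed.

Lemma card_F2_ffun n : #|{ffun 'I_n -> 'F_2}| = (2 ^ n)%N.
Proof. by rewrite card_ffun !card_ord. Qed.

Definition unbalanced_starts n L l : {set {ffun 'I_n -> 'F_2}} :=
  [set c | [exists k : 'I_(n.+1 ^ 2), let g := iter k T (monic_of c) in
     (L <= deg g)%N && (l <= imbalance (odd_times L g))%N]].

Lemma balanced_orbit_monic_of n L l (c : {ffun 'I_n -> 'F_2}) : (0 < L)%N ->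
  c \notin unbalanced_starts n L l -> balanced_orbit L l (monic_of c).
Proof.
move=> L0; rewrite inE => /existsPn bal k L_deg.
have [kn|nk] := ltnP k (n.+1 ^ 2).
  by have := bal (Ordinal kn); rewrite /= L_deg -ltnNge.
move: L_deg; rewrite iter_T_eq1 ?monic_of_neq0 ?deg_monic_of // deg1.
by rewrite leqNgt L0.
Qed.

Lemma card_unbalanced_starts n L l :
  (#|unbalanced_starts n L l| * 2 ^ L <=
     n.+1 ^ 3 * (#|[set J : {set 'I_L} | l <= imbalance J]| * 2 ^ n))%N.
Proof.
set S := [set J | _].
pose B (kd : 'I_(n.+1 ^ 2) * 'I_n.+1) : {set {ffun 'I_n -> 'F_2}} :=
  [set c | (L <= kd.2)%N && ((deg (iter kd.1 T (monic_of c)) == kd.2) &&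
       (odd_times L (iter kd.1 T (monic_of c)) \in S))].
have cover : unbalanced_starts n L l \subset \bigcup_kd B kd.
  apply/fintype.subsetP => c; rewrite inE => /existsP[k /andP[L_deg imb]].
  have deg_lt : (deg (iter k T (monic_of c)) < n.+1)%N.
    by rewrite ltnS -[leqRHS](deg_monic_of c) deg_iter_T_leq ?monic_of_neq0.
  apply/finset.bigcupP; exists (k, Ordinal deg_lt) => //.
  by rewrite !inE L_deg eqxx.
apply: (@leq_trans ((\sum_kd #|B kd|) * 2 ^ L)).
  rewrite leq_mul2r (leq_trans (subset_leq_card cover)) ?orbT //.
  exact: leq_card_bigcup.
have cell_le kd : (#|B kd| * 2 ^ L <= #|S| * 2 ^ n)%N.
  case: kd => k d; rewrite /B /=; have [Ld|dL] := leqP L d.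
    by apply: card_odd_times_block; rewrite // -ltnS.
  by rewrite (_ : [set c | _] = finset.set0) ?cards0.
rewrite big_distrl (leq_trans (leq_sum _ (fun kd _ => cell_le kd))) //=.
by rewrite sum_nat_const card_prod !card_ord -expnSr.
Qed.

(** * Mean stopping times *)

Section Averages.
Variable R : realType.

Lemma card_unbalanced_starts_chernoff n N l :
  #|unbalanced_starts n (N * l) l|%:R <=
    2 * n.+1%:R ^+ 3 * 2 ^+ n * chernoff_rate R N ^+ l.
Proof.
have pow0 : 0 < 2 ^+ (N * l) :> R by rewrite exprn_gt0.
have := card_unbalanced_starts n (N * l) l.
rewrite -(ler_nat R) natrM natrX natrM natrX natrM natrX => count_le.
rewrite -(ler_pM2r pow0) (le_trans count_le) //.
have imb_le := card_imbalanced_chernoff R (card_ord (N * l)).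
rewrite card_ord in imb_le.
have -> : 2 * n.+1%:R ^+ 3 * 2 ^+ n * chernoff_rate R N ^+ l * 2 ^+ (N * l) =
    n.+1%:R ^+ 3 * (2 * 2 ^+ (N * l) * chernoff_rate R N ^+ l * 2 ^+ n) by ring.
by rewrite ler_wpM2l ?exprn_ge0 // ler_wpM2r ?exprn_ge0.
Qed.

Lemma rho_gen_dist_le (st : F2poly -> nat) n (x K M : R)
    (A : {set {ffun 'I_n -> 'F_2}}) :
  0 <= K ->
  (forall c, c \notin A -> `|(st (monic_of c))%:R - x| <= K) ->
  (forall c : {ffun 'I_n -> 'F_2}, `|(st (monic_of c))%:R - x| <= M) ->
  `|rho_gen R st n - x| <= K + M * (#|A|%:R / 2 ^+ n).
Proof.
move=> K0 out_A all_c; have pow0 : 0 < 2 ^+ n :> R by rewrite exprn_gt0.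
have -> : rho_gen R st n - x =
    (2 ^+ n)^-1 * \sum_(c : {ffun 'I_n -> 'F_2}) ((st (monic_of c))%:R - x).
  rewrite sumrB sumr_const card_F2_ffun -[x *+ _]mulr_natl natrX mulrBr.
  by rewrite mulKf ?gt_eqF.
rewrite normrM gtr0_norm ?invr_gt0 // ler_pdivrMl //.
have pointwise (c : {ffun 'I_n -> 'F_2}) :
    `|(st (monic_of c))%:R - x| <= K + (if c \in A then M else 0).
  case: ifPn => [_|/out_A]; last by rewrite addr0.
  by rewrite (le_trans (all_c c)) // lerDr.
apply: le_trans (ler_norm_sum _ _ _) _.
apply: le_trans (ler_sum _ (fun c _ => pointwise c)) _.
rewrite big_split /= sumr_const card_F2_ffun -big_mkcond sumr_const /=.
rewrite -[K *+ _]mulr_natl -[M *+ _]mulr_natl natrX.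
rewrite mulrDr [2 ^+ n * (M * _)]mulrCA [2 ^+ n * (_ / _)]mulrC.
by rewrite divfK ?gt_eqF // [M * _]mulrC.
Qed.

Lemma tau_dist_le f : f != 0 ->
  `|(tau f)%:R - 2 * (deg f)%:R| <= (deg f).+1%:R ^+ 2 :> R.
Proof.
move=> f0; have tau_le := tau_leq f0; have tau_ge := tauE f0.
rewrite -natrX -natrM distn_natr ler_nat; nia.
Qed.

Lemma tau_balanced_dist_le P l f : (0 < P)%N -> (0 < l)%N -> f != 0 ->
  balanced_orbit (P.+1 * l) l f ->
  `|(tau f)%:R - 2 * (deg f)%:R| <=
    2 / P%:R * (deg f)%:R + (P.+1 * l)%:R ^+ 2 :> R.
Proof.
move=> P0 l0 f0 bal_f; have P0R : 0 < P%:R :> R by rewrite ltr0n.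
rewrite -(ler_pM2l P0R) -!natrM distn_natr.
have -> : P%:R * (2 / P%:R * (deg f)%:R + (P.+1 * l)%:R ^+ 2) =
    (2 * deg f + P * (P.+1 * l) ^ 2)%:R :> R.
  by rewrite !(natrD, natrM, natrX); field; rewrite gt_eqF.
by rewrite -natrM ler_nat tau_balanced.
Qed.

Lemma rho_dist_le P l n : (0 < P)%N -> (0 < l)%N ->
  `|rho R n - 2 * n%:R| <= 2 / P%:R * n%:R + (P.+1 * l)%:R ^+ 2
     + 2 * n.+1%:R ^+ 5 * chernoff_rate R P.+1 ^+ l.
Proof.
move=> P0 l0; have L0 : (0 < P.+1 * l)%N by rewrite muln_gt0.
have pow_ge0 : 0 <= n.+1%:R ^+ 2 :> R by rewrite exprn_ge0.
have bad_le : n.+1%:R ^+ 2 *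
    (#|unbalanced_starts n (P.+1 * l) l|%:R / 2 ^+ n) <=
    2 * n.+1%:R ^+ 5 * chernoff_rate R P.+1 ^+ l.
  have -> : 2 * n.+1%:R ^+ 5 * chernoff_rate R P.+1 ^+ l =
      n.+1%:R ^+ 2 * (2 * n.+1%:R ^+ 3 * chernoff_rate R P.+1 ^+ l) by ring.
  rewrite ler_wpM2l // ler_pdivrMr ?exprn_gt0 // mulrAC.
  exact: card_unbalanced_starts_chernoff.
apply: le_trans (rho_gen_dist_le _ _ _) (lerD (lexx _) bad_le) => [|c c_bal|c].
- by rewrite addr_ge0 ?exprn_ge0 // mulr_ge0 // divr_ge0.
- have bal_c := balanced_orbit_monic_of L0 c_bal.
  have := tau_balanced_dist_le P0 l0 (monic_of_neq0 c) bal_c.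
  by rewrite deg_monic_of.
- by have := tau_dist_le (monic_of_neq0 c); rewrite deg_monic_of.
Qed.

End Averages.

Lemma exprn_geometric_cube_root_le (R : realFieldType) (q : R) m n :
  0 < q -> q < 1 -> (0 < m)%N -> (n < m.+1 ^ 3)%N ->
  n.+1%:R ^+ 5 * q ^+ (16 * m) <= 2 ^+ 15 * (q^-1 - 1) ^- 16 / m%:R.
Proof.
move=> q0 q1 m0 nm; have m0R : 0 < m%:R :> R by rewrite ltr0n.
have n_le : n.+1%:R ^+ 5 <= (2 * m%:R) ^+ 15 :> R.
  rewrite -[15%N]/(3 * 5)%N exprM lerXn2r ?nnegrE ?exprn_ge0 ?mulr_ge0 //.
  by rewrite -natrM -natrX ler_nat (leq_trans nm) // leq_exp2r //; lia.
apply: (@le_trans _ _ ((2 * m%:R) ^+ 15 * q ^+ (16 * m))).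
  by rewrite ler_wpM2r ?exprn_ge0 ?(ltW q0).
have -> : (2 * m%:R) ^+ 15 * q ^+ (16 * m) =
    2 ^+ 15 * (m%:R * q ^+ m) ^+ 16 / m%:R.
  by rewrite [(16 * m)%N]mulnC exprM; field; rewrite gt_eqF.
rewrite ler_pM2r ?invr_gt0 // ler_pM2l ?exprn_gt0 // -exprVn.
rewrite lerXn2r ?natr_mul_exprn_le // nnegrE.
  by rewrite mulr_ge0 ?exprn_ge0 ?(ltW q0).
by rewrite invr_ge0 subr_ge0 invf_ge1 // ltW.
Qed.

Local Open Scope classical_set_scope.

Section Limits.
Variable R : realType.

(* With blocks of length of order [m ~ n ^ (1 / 3)] the squared length is
   negligible against [n], and [q ^ (16 m)] absorbs
   [(n + 1) ^ 5 <= (2 m) ^ 15]. *)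
Lemma rho_rate P : (0 < P)%N -> exists C : R,
  forall m n : nat, (0 < m)%N -> (m ^ 3 <= n < m.+1 ^ 3)%N ->
    `|rho R n / n%:R - 2| <= 2 / P%:R + C / m%:R.
Proof.
move=> P0; set q := chernoff_rate R P.+1.
have q0 : 0 < q := chernoff_rate_gt0 R P.+1.
have q1 : q < 1 := chernoff_rate_lt1 R (ltn0Sn P).
have h0 : 0 < q^-1 - 1 by rewrite subr_gt0 invf_gt1.
pose D : R := 2 ^+ 15 * (q^-1 - 1) ^- 16.
exists ((P.+1 * 16)%:R ^+ 2 + 2 * D) => m n m0 /andP[mn nm].
have m0R : 0 < m%:R :> R by rewrite ltr0n.
have m3n : m%:R ^+ 3 <= n%:R :> R by rewrite -natrX ler_nat.
have n1 : 1 <= n%:R :> R by rewrite ler1n (leq_trans _ mn) ?expn_gt0 ?m0.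
have n0 : 0 < n%:R :> R by apply: lt_le_trans n1.
have block :
    (P.+1 * (16 * m))%:R ^+ 2 <= (P.+1 * 16)%:R ^+ 2 / m%:R * n%:R :> R.
  rewrite mulnA natrM exprMn -mulrA ler_wpM2l ?exprn_ge0 //.
  by rewrite mulrC ler_pdivlMr // -exprSr.
have tail : 2 * n.+1%:R ^+ 5 * q ^+ (16 * m) <= 2 * D / m%:R * n%:R.
  apply: (@le_trans _ _ (2 * D / m%:R)); last first.
    by rewrite ler_peMr // divr_ge0 ?mulr_ge0 ?invr_ge0 ?exprn_ge0 ?(ltW h0).
  by rewrite -mulrA -[leRHS]mulrA ler_pM2l // exprn_geometric_cube_root_le.
have -> : rho R n / n%:R - 2 = (rho R n - 2 * n%:R) / n%:R.
  by rewrite mulrBl mulfK // gt_eqF.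
rewrite normrM [`|n%:R^-1|]gtr0_norm ?invr_gt0 // ler_pdivrMr //.
have l0 : (0 < 16 * m)%N by rewrite muln_gt0.
apply: le_trans (rho_dist_le R n P0 l0) _; rewrite -/q.
rewrite [leRHS]mulrDl [X in _ <= _ + X * _]mulrDl [X in _ <= _ + X]mulrDl.
by rewrite -addrA lerD2l lerD.
Qed.

Lemma rho_cvg : (fun n : nat => rho R n / n%:R) @ \oo --> (2 : R).
Proof.
apply/cvgrPdist_le => e e0; have e2 : 0 < e / 2 by rewrite divr_gt0.
have small_ratio (a : R) : exists2 k : nat, (0 < k)%N &
    forall m : nat, (k <= m)%N -> a / m%:R <= e / 2.
  exists (Num.truncn (a / (e / 2))).+1 => // m km.
  have m0 : 0 < m%:R :> R by rewrite ltr0n (leq_trans _ km).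
  rewrite ler_pdivrMr // mulrC -ler_pdivrMr // ltW //.
  by apply: lt_le_trans (truncnS_gt _) _; rewrite ler_nat.
have [P P0 P_small] := small_ratio 2.
have [C rate] := rho_rate P0; have [k k0 C_small] := small_ratio C.
exists (k ^ 3)%N => // n /= kn; have [m mn] := floor_root n (isT : (0 < 3)%N).
have km : (k <= m)%N.
  by rewrite -ltnS -(@ltn_exp2r _ _ 3) // (leq_ltn_trans kn) //; case/andP: mn.
rewrite distrC (le_trans (rate m n _ mn)) ?(leq_trans k0) //.
by rewrite [leRHS]splitr lerD ?P_small ?C_small.
Qed.

Lemma rho0E n : rho0 R n = 2 * rho R n - n%:R.
Proof.
pose shift (c : {ffun 'I_n -> 'F_2}) :=
  [ffun i : 'I_n => (monic_of c \Po X1)`_i].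
have monic_of_shift c : monic_of (shift c) = monic_of c \Po X1.
  have size_shift : size (monic_of c \Po X1) = n.+1.
    by rewrite size_comp_poly2 ?size_monic_of // X1E size_XsubC.
  by apply: monic_of_coef; rewrite ?F2poly_monic // -size_poly_eq0 size_shift.
have shift_inj : injective shift.
  move=> c c' /(congr1 (@monic_of n)); rewrite !monic_of_shift.
  by move=> /(can_inj comp_X1K); apply: monic_of_inj.
rewrite /rho0 /rho /rho_gen (reindex_inj shift_inj) /=.
have tau0_shift c :
    (tau0 (monic_of (shift c)))%:R = 2 * (tau (monic_of c))%:R - n%:R :> R.
  rewrite monic_of_shift -natrM -tau0_comp ?monic_of_neq0 // deg_monic_of.
  by rewrite natrD addrK.
under eq_bigr do rewrite tau0_shift.
rewrite sumrB sumr_const card_F2_ffun -mulr_sumr mulrBr mulrCA; congr (_ - _).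
by rewrite -[_ *+ (2 ^ n)]mulr_natl natrX mulKf // gt_eqF // exprn_gt0.
Qed.

End Limits.

Theorem theorem2p14 (R : realType) :
  ((fun n : nat => rho R n / n%:R) @ \oo --> (2%:R : R)) /\
  ((fun n : nat => rho0 R n / n%:R) @ \oo --> (3%:R : R)).
Proof.
split; first exact: rho_cvg.
have -> : 3 = 2 * 2 - 1 :> R by lra.
have : (fun n : nat => 2 * (rho R n / n%:R) - 1) @ \oo --> (2 * 2 - 1 : R).
  by apply: cvgB; [apply: cvgMr; exact: rho_cvg | exact: cvg_cst].
apply: cvg_trans; apply: near_eq_cvg; near=> n.
have n0 : n%:R != 0 :> R.
  by rewrite pnatr_eq0 -lt0n; near: n; exact: nbhs_infty_gt.
by rewrite rho0E mulrBl divff // mulrA.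
Unshelve. all: by end_near.
Qed.
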